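(* Let $\{H_\omega\}_{\omega\in\Omega}$ be an ergodic family of discrete Schrödinger operators on $\mathbb{Z}$ with bounded potential, with almost sure spectrum $\sigma$ and Lyapunov exponent $\gamma(E)$, and assume that it satisfies the uniform large deviation (uniform-LDT) condition. Fix $\epsilon_0>0$. Then for a.e. $\omega$ there exists $N_2(\omega)$ such that for every $n>N_2(\omega)$ and every $E\in\sigma$, \[ |P_{[0,n],E,\omega}|\le e^{(\gamma(E)+\epsilon_0)(n+1)}. \]
   Context: Ergodic family: $(\Omega,\mathbb{P})$ is a probability space, $T:\Omega\to\Omega$ an invertible measure-preserving ergodic transformation, $V:\Omega\to\mathbb{R}$ bounded and measurable, and $(H_\omega\Psi)(n)=\Psi(n+1)+\Psi(n-1)+V(T^n\omega)\Psi(n)$ on $\ell^2(\mathbb{Z})$. The spectrum of $H_\omega$ equals a fixed compact set $\sigma\subset\mathbb{R}$ for a.e. $\omega$. For integers $a\le b$, $H_{[a,b],\omega}$ is the restriction of $H_\omega$ to $[a,b]$ with zero boundary conditions (a $(b-a+1)\times(b-a+1)$ matrix), and $P_{[a,b],E,\omega}=\det(H_{[a,b],\omega}-E)$. Transfer matrices: $T_{[a,b],E,\omega}=A_b\cdots A_{a}$ with $A_j=\begin{pmatrix}E-V(T^j\omega)&-1\\1&0\end{pmatrix}$. Lyapunov exponent: $\gamma(E)=\lim_{n\to\infty}\frac1n\int_\Omega\log\|T_{[0,n],E,\omega}\|\,d\mathbb{P}(\omega)$. Uniform-LDT condition: for every compact set $J\subset\mathbb{R}$ and every $\epsilon>0$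 there exist $\eta=\eta(\epsilon)>0$ and $N_0=N_0(\epsilon)$ such that for all integers $a,b$ with $b-a>N_0$ and all $E\in J$, \[ \mathbb{P}\left\{\omega:\left|\tfrac{1}{b-a+1}\log|P_{[a,b],E,\omega}|-\gamma(E)\right|\ge\epsilon\right\}\le e^{-\eta(b-a+1)} \] (with $\log 0=-\infty$). *)

(* Defs.v *)
From mathcomp Require Import all_boot all_order all_algebra.
From mathcomp Require Import all_classical all_reals all_analysis.
From mathcomp Require Import complex.

Set Implicit Arguments.
Unset Strict Implicit.
Unset Printing Implicit Defensive.

Import Order.TTheory GRing.Theory Num.Theory.
Import numFieldNormedType.Exports.

Local Open Scope classical_set_scope.
Local Open Scope ring_scope.

Definition iterz (X : Type) (T Tinv : X -> X) (n : int) : X -> X :=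
  match n with
  | Posz k => iter k T
  | Negz k => iter k.+1 Tinv
  end.

Section Dynamics.
Context (R : realType) (d : measure_display) (Omega : measurableType d).
Variable P : probability Omega R.

Definition invertible_measure_preserving (T Tinv : Omega -> Omega) : Prop :=
  [/\ cancel T Tinv, cancel Tinv T,
      measurable_fun setT T, measurable_fun setT Tinv &
      forall A, measurable A -> P (T @^-1` A) = P A].

Definition ergodic (T : Omega -> Omega) : Prop :=
  forall A, measurable A -> T @^-1` A = A -> P A = 0%E \/ P A = 1%E.

End Dynamics.

(* K is a parameter so that the same operator acts on complex sequences (for
   the spectrum) and on real ones (for the finite-volume determinants). *)
Definition schrodinger (K : nzRingType) (v : int -> K) (psi : int -> K) :
    int -> K :=
  fun n => psi (n + 1) + psi (n - 1) + v n * psi n.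

Section Spectrum.
Context (R : realType).

Definition l2_sqnorm (psi : int -> R[i]) : \bar R :=
  \esum_(n in [set: int]) (complex.Re (psi n) ^+ 2 + complex.Im (psi n) ^+ 2)%:E.

Definition l2 : set (int -> R[i]) := [set psi | (l2_sqnorm psi < +oo)%E].

(* [B] is a bounded two-sided inverse of [A - z] on l2(Z); such a [B] is
   automatically linear on l2(Z) when [A] is. *)
Definition resolvent_set (A : (int -> R[i]) -> (int -> R[i])) : set R[i] :=
  [set z | exists B : (int -> R[i]) -> (int -> R[i]),
    [/\ forall psi, l2 psi -> l2 (B psi),
        exists M : R, forall psi, l2 psi ->
          (l2_sqnorm (B psi) <= (M ^+ 2)%:E * l2_sqnorm psi)%E,
        forall psi, l2 psi -> (fun n => A (B psi) n - z * B psi n) = psi &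
        forall psi, l2 psi -> B (fun n => A psi n - z * psi n) = psi]].

Definition spectrum (A : (int -> R[i]) -> (int -> R[i])) : set R[i] :=
  ~` resolvent_set A.

End Spectrum.

Section ErgodicSchrodinger.
Context (R : realType) (d : measure_display) (Omega : measurableType d).
Variable P : probability Omega R.
Variables (T Tinv : Omega -> Omega) (V : Omega -> R).

Definition potential (omega : Omega) (n : int) : R := V (iterz T Tinv n omega).

Definition H (omega : Omega) : (int -> R[i]) -> (int -> R[i]) :=
  schrodinger (fun n => real_complex R (potential omega n)).

Definition almost_sure_spectrum (sigma : set R) : Prop :=
  compact sigma /\
  {ae P, forall omega, spectrum (H omega) = real_complex R @` sigma}.

(* The size is |b - a + 1|, so this is meaningful only for a <= b. Entry (i, j)
   is the value at a + i of H_omega applied to the delta function at a + j. *)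
Definition box_H (a b : int) (omega : Omega) : 'M[R]_(absz (b - a + 1)) :=
  \matrix_(i, j) schrodinger (potential omega)
    (fun n => (n == a + j%:Z)%:R) (a + i%:Z).

Definition box_det (a b : int) (E : R) (omega : Omega) : R :=
  \det (box_H a b omega - E%:M).

Definition one_step (E : R) (omega : Omega) (j : int) : 'M[R]_2 :=
  \matrix_(i, k) match val i, val k with
                 | 0%N, 0%N => E - potential omega j
                 | 0%N, _ => -1
                 | _, 0%N => 1
                 | _, _ => 0
                 end.

(* A_b * A_(b-1) * ... * A_a, for a <= b. *)
Definition transfer (a b : int) (E : R) (omega : Omega) : 'M[R]_2 :=
  \prod_(i < absz (b - a + 1)) one_step E omega (b - i%:Z).

Definition euclid_norm (x : 'cV[R]_2) : R := Num.sqrt (\sum_i x i ord0 ^+ 2).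

Definition op_norm (A : 'M[R]_2) : R :=
  sup [set euclid_norm (A *m x) | x in [set x | euclid_norm x <= 1]].

Definition lyapunov (E : R) : R :=
  lim ((fun n : nat => n%:R^-1 *
    \int[P]_(omega in [set: Omega]) ln (op_norm (transfer 0 n%:Z E omega)))
    @ \oo).

(* [lne 0 = -oo], so a vanishing determinant belongs to the deviation event. *)
Definition deviation_event (a b : int) (E eps : R) : set Omega :=
  [set omega | (eps%:E <=
    `| ((b - a + 1)%:~R^-1)%:E * lne `|box_det a b E omega|%:E
       - (lyapunov E)%:E |)%E].

Definition uniform_LDT : Prop :=
  forall J : set R, compact J -> forall eps : R, 0 < eps ->
  exists eta : R, 0 < eta /\ exists N0 : nat,
  forall a b : int, N0%:Z < b - a -> forall E : R, J E ->
    (P (deviation_event a b E eps) <= (expR (- eta * (b - a + 1)%:~R))%:E)%E.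

End ErgodicSchrodinger.

(* Main.v *)
Require Import Defs.
From mathcomp Require Import all_boot all_order all_algebra.
From mathcomp Require Import all_classical all_reals all_analysis.
From mathcomp Require Import measurable_realfun ring lra.
Import Order.TTheory GRing.Theory Num.Theory.
Import numFieldNormedType.Exports.
Local Open Scope classical_set_scope.
Local Open Scope ring_scope.

(* The function gamma is continuous: at a fixed large scale the determinant is
   Lipschitz in E uniformly in omega, and the exceptional sets of two nearby
   energies do not cover Omega, so some omega compares the two exponents.
   Near a given energy gamma is therefore almost constant. The determinant on
   [0, n] is a polynomial of degree n + 1 in E; on an interval it is bounded by
   2 (n + 2) times its maximum over n + 2 deterministic, approximately Fekete,
   nodes. By Borel-Cantelli the large deviation bound holds eventually at all
   the nodes, hence the upper bound holds on the whole interval, and finitely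
   many such intervals cover the compact spectrum. *)

(** * Polynomial interpolation and approximate Fekete nodes *)

Lemma lagrange_interpolation (F : fieldType) (n : nat) (a : 'I_n -> F)
    (p : {poly F}) (t : F) : injective a -> (size p <= n)%N ->
  p.[t] = \sum_i p.[a i] * \prod_(j | j != i) ((t - a j) / (a i - a j)).
Proof.
move=> a_inj sp.
pose q := \sum_i (p.[a i])%:P *
  \prod_(j | j != i) (((a i - a j)^-1)%:P * ('X - (a j)%:P)).
have qE u : q.[u] = \sum_i p.[a i] * \prod_(j | j != i) ((u - a j) / (a i - a j)).
  rewrite horner_sum; apply: eq_bigr => i _; rewrite hornerM hornerC horner_prod.
  by congr (_ * _); apply: eq_bigr => j _; rewrite hornerM hornerC hornerXsubC mulrC.
rewrite -qE; suff /eqP : p - q = 0 by rewrite subr_eq0 => /eqP ->.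
(* [p - q] has size at most [n] and vanishes at the [n] distinct nodes. *)
apply: (@roots_geq_poly_eq0 _ _ [seq a i | i <- enum 'I_n]).
- apply/allP => _ /mapP[i _ ->]; rewrite rootE hornerD hornerN subr_eq0 qE.
  rewrite (bigD1 i)//= [X in _ + X]big1 => [|k ki]; last first.
    by rewrite (bigD1 i) 1?eq_sym//= subrr mul0r mul0r mulr0.
  rewrite addr0 big1 ?mulr1// => j ji.
  by rewrite divff// subr_eq0 eq_sym; apply: contraNneq ji => /a_inj ->.
- by rewrite map_inj_uniq ?enum_uniq.
- rewrite size_map size_enum_ord (leq_trans (size_polyD _ _))// size_polyN geq_max sp/=.
  apply: (leq_trans (size_sum _ _ _)); apply/bigmax_leqP => i _.
  rewrite mul_polyC (leq_trans (size_scale_leq _ _))//.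
  rewrite (leq_trans (size_poly_prod_leq _ _))//= leq_subLR.
  apply: (@leq_trans (\sum_(j < n | j != i) 2).+1).
    rewrite ltnS leq_sum// => j _; rewrite mul_polyC (leq_trans (size_scale_leq _ _))//.
    by rewrite size_XsubC.
  rewrite sum_nat_const cardC1 card_ord muln2 -addnn -addnS leq_add2l.
  by case: (n) i => [[]|].
Qed.

Section Fekete.
Context {R : realType} {n : nat}.
Implicit Types (a : 'I_n -> R) (K : set R).

Let offdiag_prod a := \prod_i \prod_(j | j != i) `|a i - a j|.

(** A pair containing [k] occurs in both orders, hence the square; the last factor does not involve
    [a k]. *)
Let offdiag_prodE a k : offdiag_prod a = (\prod_(j | j != k) `|a k - a j|) ^+ 2 *
  \prod_(i | i != k) \prod_(j | (j != i) && (j != k)) `|a i - a j|.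
Proof.
rewrite /offdiag_prod (bigD1 k)//= expr2 -mulrA; congr (_ * _).
rewrite -big_split/=; apply: eq_bigr => i ik.
by rewrite (bigD1 k) 1?eq_sym//= distrC.
Qed.

Let offdiag_prod_gt0 a : injective a -> 0 < offdiag_prod a.
Proof.
move=> a_inj; apply: prodr_gt0 => i _; apply: prodr_gt0 => j ji.
by rewrite normr_gt0 subr_eq0; apply: contraNneq ji => /a_inj ->.
Qed.

(* Nodes whose product of mutual distances is at least half of its supremum:
   moving one node to [t] multiplies that product by the square of the
   corresponding Lagrange basis polynomial at [t]. *)
Lemma approximate_fekete_points K (B : R) a0 :
    (forall x, K x -> `|x| <= B) -> (forall i, K (a0 i)) -> injective a0 ->
  exists a, [/\ forall i, K (a i), injective a &
    forall t i, K t -> `|\prod_(j | j != i) ((t - a j) / (a i - a j))| <= 2].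
Proof.
move=> KB Ka0 a0_inj.
pose S := [set offdiag_prod a | a in [set a | forall i, K (a i)]].
have Sa0 : S (offdiag_prod a0) by exists a0.
have S_sup : has_sup S.
  split; first by exists (offdiag_prod a0).
  exists (\prod_(i < n) \prod_(j < n | j != i) (B + B)) => _ [a Ka <-].
  apply: ler_prod => i _; rewrite prodr_ge0//=; apply: ler_prod => j _.
  by rewrite normr_ge0/= (le_trans (ler_normB _ _))// lerD// KB.
(* The distinct points [a0] make the supremum positive, so half of it is a positive lower bound and
   a near-maximiser has distinct nodes. *)
have S_gt0 : 0 < sup S.
  by rewrite (lt_le_trans (offdiag_prod_gt0 a0 a0_inj))// ub_le_sup//; case: S_sup.
have [_ [a Ka <-] a_half] := sup_adherent (divr_gt0 S_gt0 (ltr0n R 2)) S_sup.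
have a_gt0 : 0 < offdiag_prod a by lra.
exists a; split => //.
  move=> i j aij; apply/eqP/contraT => ij; move: a_gt0.
  by rewrite /offdiag_prod (bigD1 i)//= (bigD1 j) 1?eq_sym//= aij subrr normr0 !mul0r ltxx.
move=> t i Kt.
pose a' j := if j == i then t else a j.
have : offdiag_prod a' <= sup S.
  apply: ub_le_sup; first by case: S_sup.
  by exists a' => //= j; rewrite /a'; case: ifP.
have -> : offdiag_prod a' = (\prod_(j | j != i) `|t - a j|) ^+ 2 *
  \prod_(k | k != i) \prod_(j | (j != k) && (j != i)) `|a k - a j|.
  rewrite (offdiag_prodE _ i); congr (_ ^+ 2 * _).
    by apply: eq_bigr => j ji; rewrite /a' eqxx (negbTE ji).
  apply: eq_bigr => k ki; apply: eq_bigr => j /andP[_ ji].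
  by rewrite /a' (negbTE ji) (negbTE ki).
have -> : `|\prod_(j | j != i) ((t - a j) / (a i - a j))| =
    (\prod_(j | j != i) `|t - a j|) / \prod_(j | j != i) `|a i - a j|.
  by rewrite normr_prod -prodf_div; apply: eq_bigr => j _; rewrite normrM normfV.
move: a_half a_gt0; rewrite (offdiag_prodE a i).
set num := \prod_(j | _) `|t - _|; set den := \prod_(j | _) _; set c := \prod_(k | _) _.
move=> a_half a_gt0 a'S.
have c_ge0 : 0 <= c by do 2 (apply: prodr_ge0 => ? _).
have num_ge0 : 0 <= num by apply: prodr_ge0.
have den_ge0 : 0 <= den by apply: prodr_ge0.
have den_gt0 : 0 < den.
  rewrite lt_neqAle den_ge0 andbT eq_sym; apply: contraTneq a_gt0 => ->.
  by rewrite expr0n mul0r ltxx.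
have c_gt0 : 0 < c.
  by rewrite lt_neqAle c_ge0 andbT eq_sym; apply: contraTneq a_gt0 => ->; rewrite mulr0 ltxx.
rewrite ler_pdivrMr// -ler_sqr ?nnegrE ?mulr_ge0// -(ler_pM2r c_gt0) exprMn.
(* Here [num ^+ 2 * c <= sup S < 2 * (den ^+ 2 * c)], which is more than enough for
   [num <= 2 * den]. *)
by nra.
Qed.

(** In Lagrange's formula each of the [n] basis polynomials is at most 2 on [K]. The nodes precede
    [p], so one choice serves the determinants of all [omega]. *)
Lemma polynomial_bound_from_nodes K (B : R) a0 :
    (forall x, K x -> `|x| <= B) -> (forall i, K (a0 i)) -> injective a0 ->
  exists a, (forall i, K (a i)) /\
    forall (p : {poly R}) (M : R), (size p <= n)%N -> (forall i, `|p.[a i]| <= M) ->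
    forall t, K t -> `|p.[t]| <= (2 * n)%:R * M.
Proof.
move=> KB Ka0 a0_inj.
have [a [Ka a_inj a2]] := approximate_fekete_points K B a0 KB Ka0 a0_inj.
exists a; split=> // p M sp pM t Kt; rewrite (lagrange_interpolation _ _ a p t a_inj sp).
apply: le_trans (ler_norm_sum _ _ _) _.
apply: (@le_trans _ _ (\sum_(i < n) M * 2)).
  by apply: ler_sum => i _; rewrite normrM ler_pM// a2.
by rewrite sumr_const card_ord -mulr_natr natrM; lra.
Qed.

End Fekete.

(** * Determinants as functions of the energy and of a parameter *)

(** Turns the box determinant, up to sign, into a polynomial in the energy, to which interpolation
    applies. *)
Lemma norm_det_char_poly (R : realDomainType) (n : nat) (A : 'M[R]_n) (x : R) :
  `|\det (A - x%:M)| = `|(char_poly A).[x]|.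
Proof.
have -> : (char_poly A).[x] = \det (x%:M - A).
  rewrite /char_poly horner_sum; apply: eq_bigr => s _.
  rewrite hornerM horner_exp !hornerE; congr (_ * _).
  rewrite horner_prod; apply: eq_bigr => i _.
  by rewrite !mxE !(hornerE, hornerMn).
by rewrite -opprB -scaleN1r detZ normrM normrX normrN1 expr1n mul1r.
Qed.

Section EquiLipschitz.
Context {R : realType} {X : Type} (J : set R).
Implicit Types f g : R -> X -> R.

(** The bound [M] accompanies the Lipschitz constant because products need both; neither depends on
    the parameter [x]. *)
Definition equi_lipschitz f := exists M L : R, forall E E' x, J E -> J E' ->
  `|f E x| <= M /\ `|f E x - f E' x| <= L * `|E - E'|.

Lemma equi_lipschitz_cst (c : X -> R) (M : R) : (forall x, `|c x| <= M) ->
  equi_lipschitz (fun=> c).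
Proof. by move=> cM; exists M, 0 => *; rewrite subrr normr0 mul0r. Qed.

Lemma equi_lipschitzD f g : equi_lipschitz f -> equi_lipschitz g ->
  equi_lipschitz (fun E x => f E x + g E x).
Proof.
move=> [M [L fL]] [M' [L' gL]]; exists (M + M'), (L + L') => E E' x JE JE'.
have [fM f_lip] := fL _ _ x JE JE'; have [gM g_lip] := gL _ _ x JE JE'.
split; first by rewrite (le_trans (ler_normD _ _))// lerD.
by rewrite opprD addrACA mulrDl (le_trans (ler_normD _ _))// lerD.
Qed.

Lemma equi_lipschitzM f g : equi_lipschitz f -> equi_lipschitz g ->
  equi_lipschitz (fun E x => f E x * g E x).
Proof.
move=> [M [L fL]] [M' [L' gL]]; exists (M * M'), (M * L' + L * M') => E E' x JE JE'.
have [fM f_lip] := fL _ _ x JE JE'; have [_ g_lip] := gL _ _ x JE JE'.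
have [gM' _] := gL _ _ x JE' JE'; have [gM _] := gL _ _ x JE JE.
split; first by rewrite normrM ler_pM.
have -> : f E x * g E x - f E' x * g E' x =
  f E x * (g E x - g E' x) + (f E x - f E' x) * g E' x by ring.
rewrite (le_trans (ler_normD _ _))// [leRHS]mulrDl lerD// normrM.
  by rewrite -mulrA ler_pM.
by rewrite mulrAC ler_pM.
Qed.

Lemma equi_lipschitz_det n (A : R -> X -> 'M[R]_n) :
  (forall i j, equi_lipschitz (fun E x => A E x i j)) ->
  equi_lipschitz (fun E x => \det (A E x)).
Proof.
move=> A_lip.
have sum_lip I (r : seq I) (F : I -> R -> X -> R) :
    (forall i, equi_lipschitz (F i)) ->
    equi_lipschitz (fun E x => \sum_(i <- r) F i E x).
  move=> F_lip; elim: r => [|i r IHr].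
    under eq_fun do under eq_fun do rewrite big_nil.
    by apply: (equi_lipschitz_cst (fun=> 0) 0) => x; rewrite normr0.
  under eq_fun do under eq_fun do rewrite big_cons.
  exact: equi_lipschitzD.
have prod_lip I (r : seq I) (F : I -> R -> X -> R) :
    (forall i, equi_lipschitz (F i)) ->
    equi_lipschitz (fun E x => \prod_(i <- r) F i E x).
  move=> F_lip; elim: r => [|i r IHr].
    under eq_fun do under eq_fun do rewrite big_nil.
    by apply: (equi_lipschitz_cst (fun=> 1) 1) => x; rewrite normr1.
  under eq_fun do under eq_fun do rewrite big_cons.
  exact: equi_lipschitzM.
apply: sum_lip => s; apply: equi_lipschitzM; last by apply: prod_lip.
by apply: (equi_lipschitz_cst (fun=> _) 1) => x; rewrite normr_sign.
Qed.

End EquiLipschitz.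

Lemma measurable_det d (X : measurableType d) (R : realType) n (A : X -> 'M[R]_n) :
  (forall i j, measurable_fun setT (fun x => A x i j)) ->
  measurable_fun setT (fun x => \det (A x)).
Proof.
move=> mA; apply: measurable_sum => s; apply: measurable_funM => //.
by apply: measurable_prod => i _.
Qed.

(** Read as [1 - expR (- s) <= expR s - 1], it lets one closeness condition give bounds on both
    sides. *)
Lemma expR_sum_ge2 (R : realType) (s : R) : 2 <= expR s + expR (- s).
Proof. have := expR_ge1Dx s; have := expR_ge1Dx (- s); lra. Qed.

(** * Box determinants and deviation events *)

Section BoxDeterminant.
Context {R : realType} {d : measure_display} {Omega : measurableType d}.
Context (P : probability Omega R) (T Tinv : Omega -> Omega) (V : Omega -> R).
Hypothesis T_measurable : measurable_fun setT T.
Hypothesis V_measurable : measurable_fun setT V.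
Hypothesis V_bounded : exists M : R, forall omega, `|V omega| <= M.

Local Notation det n E omega := (box_det T Tinv V 0 n%:Z E omega).
Local Notation gamma := (lyapunov P T Tinv V).

Lemma measurable_box_det (n : nat) E : measurable_fun setT (fun omega => det n E omega).
Proof.
have iter_measurable k : measurable_fun setT (iter k T).
  by elim: k => [|k IHk]; [exact: measurable_id | exact: (measurableT_comp T_measurable)].
apply: measurable_det => i j.
under eq_fun do rewrite !mxE.
apply: measurable_funB => //; apply: measurable_funD => //.
apply: measurable_funM => //; apply: (measurableT_comp V_measurable) => /=.
exact: iter_measurable.
Qed.

Lemma box_det_lipschitz (n : nat) (B : R) : exists2 L, 0 < L & forall E E' omega,
  `|E| <= B -> `|E'| <= B -> `|det n E omega - det n E' omega| <= L * `|E - E'|.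
Proof.
have [M VM] := V_bounded.
suff [M' [L det_lip]] : equi_lipschitz [set E : R | `|E| <= B]
    (fun E omega => det n E omega).
  (* The maximum with 1 makes the constant positive, so that it can be divided by. *)
  exists (Num.max L 1); first by rewrite lt_max ltr01 orbT.
  move=> E E' omega EB E'B; have [_ /le_trans->//] := det_lip E E' omega EB E'B.
  by rewrite ler_wpM2r// le_max lexx.
apply: equi_lipschitz_det => i j.
pose c omega := schrodinger (potential T Tinv V omega)
  (fun k => (k == 0 + j%:Z)%:R) (0 + i%:Z).
rewrite (_ : (fun E omega => _) = fun E omega => c omega + - (E *+ (i == j))); last first.
  by apply/funext => E; apply/funext => omega; rewrite !mxE.
have delta_le1 (b : bool) : `|b%:R : R| <= 1 by case: b; rewrite ?normr1 ?normr0.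
apply: equi_lipschitzD.
  (* Two hopping terms, each at most 1, and the potential. *)
  apply: (equi_lipschitz_cst _ c (1 + 1 + M)) => omega.
  rewrite (le_trans (ler_normD _ _))// lerD//.
    by rewrite (le_trans (ler_normD _ _))// lerD.
  by rewrite normrM -[M]mulr1 ler_pM// VM.
exists B, 1 => E E' omega; case: (i == j) => /= EB E'B.
  by rewrite !mulr1n normrN -opprD normrN mul1r.
by rewrite !mulr0n oppr0 normr0 subrr normr0 mul1r (le_trans _ EB).
Qed.

(** Exponentiating removes the logarithm. A zero determinant lies in both sets: its logarithm is at
    infinite distance from [gamma E], and it violates the strict lower bound. *)
Lemma deviation_eventE (n : nat) (E eps : R) :
  deviation_event P T Tinv V 0 n%:Z E eps =
  ~` [set omega | expR ((gamma E - eps) * n.+1%:R) < `|det n E omega|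
                  < expR ((gamma E + eps) * n.+1%:R)].
Proof.
have Sn_gt0 : (0 : R) < n.+1%:R by rewrite ltr0n.
have nE : ((n%:Z - 0 + 1)%:~R : R) = n.+1%:R by rewrite subr0 -natr1 rmorphD.
have small omega : (0 < `|det n E omega|) ->
  (eps%:E <= `| (n.+1%:R^-1)%:E * lne `|det n E omega|%:E - (gamma E)%:E |)%E =
  ~~ (expR ((gamma E - eps) * n.+1%:R) < `|det n E omega|
                  < expR ((gamma E + eps) * n.+1%:R)).
  move=> det_gt0; rewrite lne_EFin// -EFinM -EFinB abse_EFin lee_fin leNgt.
  rewrite ltr_distl; congr (~~ (_ && _)).
    by rewrite [X in _ < X]mulrC ltr_pdivlMr// -[LHS]ltr_expR lnK ?posrE.
  by rewrite [X in X < _]mulrC ltr_pdivrMr// -[LHS]ltr_expR lnK ?posrE.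
apply/seteqP; split=> omega; rewrite /deviation_event /setC /mkset nE.
  move=> + good; rewrite small ?good//.
  by case/andP : good => /(lt_trans _) -> //; exact: expR_gt0.
move=> /negP; have [det_gt0|] := boolP (0 < `|det n E omega|); first by rewrite small.
rewrite -leNgt => det_le0 _.
by rewrite le0_lneNy ?lee_fin// gt0_muleNy ?lte_fin ?invr_gt0// leey.
Qed.

Lemma measurable_deviation_event (n : nat) (E eps : R) :
  measurable (deviation_event P T Tinv V 0 n%:Z E eps).
Proof.
rewrite deviation_eventE; apply: measurableC; rewrite -[X in measurable X]setTI.
have -> : [set: Omega] `&` [set omega | expR ((gamma E - eps) * n.+1%:R)
    < `|det n E omega| < expR ((gamma E + eps) * n.+1%:R)] =
  [set: Omega] `&` (fun omega => `|det n E omega|) @^-1`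
    `](expR ((gamma E - eps) * n.+1%:R)), (expR ((gamma E + eps) * n.+1%:R))[%classic.
  by apply/seteqP; split => omega /=; rewrite in_itv.
have := measurable_box_det n E => /(measurableT_comp (@normr_measurable R setT)).
by apply => //; exact: measurable_itv.
Qed.

End BoxDeterminant.

(** * Elementary estimates, nodes in an interval, and Borel-Cantelli *)

Lemma eventually_natr_ge (R : realType) (x : R) :
  exists N, forall n, (N <= n)%N -> x <= n%:R.
Proof.
exists (Num.Def.truncn x).+1 => n Nn.
by rewrite (le_trans (ltW (truncnS_gt x)))// ler_nat.
Qed.

(** Half of the decay absorbs the linear factor, by [1 + s <= expR s]. With [k = n + 1] this makes a
    union bound over [n + 2] nodes geometric. *)
Lemma linear_mul_expRN_le (R : realType) (eta k : R) : 0 < eta -> 0 <= k ->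
  (k + 1) * expR (- eta * k) <= (1 + 2 / eta) * expR (- (eta / 2) * k).
Proof.
move=> eta_gt0 k_ge0.
have -> : - eta * k = - (eta / 2) * k + - (eta / 2) * k by lra.
rewrite expRD mulrA ler_wpM2r ?expR_ge0// mulNr expRN ler_pdivrMr ?expR_gt0//.
apply: (@le_trans _ _ ((1 + 2 / eta) * (1 + eta / 2 * k))).
  have -> : (1 + 2 / eta) * (1 + eta / 2 * k) = 1 + 2 / eta + eta / 2 * k + k.
    by field; rewrite gt_eqF.
  have := divr_ge0 (ler0n R 2) (ltW eta_gt0).
  by have := mulr_ge0 (divr_ge0 (ltW eta_gt0) (ler0n R 2)) k_ge0; lra.
by rewrite ler_wpM2l ?expR_ge1Dx// addr_ge0// divr_ge0// ltW.
Qed.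

Lemma linear_le_expR_eventually (R : realType) (eps : R) : 0 < eps ->
  exists N, forall n : nat, (N <= n)%N -> (2 * n.+2)%:R <= expR (eps * n.+1%:R).
Proof.
(* With [s = eps / 2 * (n + 1)], this threshold gives [s ^+ 2 >= 4 * (n + 1)], and [expR s ^+ 2]
   dominates [(1 + s) ^+ 2]. *)
move=> eps_gt0; have [N NP] := eventually_natr_ge R (16 / eps ^+ 2).
exists N => n /NP; rewrite ler_pdivrMr ?exprn_gt0// => n_large.
have -> : eps * n.+1%:R = eps / 2 * n.+1%:R + eps / 2 * n.+1%:R by lra.
have e1 := expR_ge1Dx (eps / 2 * n.+1%:R).
rewrite expRD; apply: (@le_trans _ _ ((1 + eps / 2 * n.+1%:R) * (1 + eps / 2 * n.+1%:R))).
  rewrite natrM -[n.+2%:R]natr1 -[n.+1%:R]natr1.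
  have n0 : (0 : R) <= n%:R by [].
  set x := n%:R in n_large n0 *.
  have := mulr_ge0 (ltW eps_gt0) n0; have := sqr_ge0 eps => eps2 epsx.
  have : 16 * (x + 1) <= (eps ^+ 2 * (x + 1)) * (x + 1).
    by rewrite ler_wpM2r ?addr_ge0// mulrDr mulr1 mulrC; lra.
  by lra.
by rewrite ler_pM// addr_ge0// mulr_ge0// divr_ge0// ltW.
Qed.

Lemma norm_close_expR (R : realType) (s x y : R) :
  `|x - y| <= (1 - expR (- s)) * `|y| ->
  expR (- s) * `|y| <= `|x| <= expR s * `|y|.
Proof.
move=> xy; have := ler_normD (x - y) y; have := ler_normD (y - x) x.
have := ler_wpM2r (normr_ge0 y) (expR_sum_ge2 R s).
by rewrite !subrK (distrC y); lra.
Qed.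

(** Three errors of size [e] add up: one from each deviation bound and one from comparing [p] with
    [p']. *)
Lemma exponents_close (R : realType) (e m g g' p p' : R) : 0 < m ->
  expR ((g - e) * m) < p < expR ((g + e) * m) ->
  expR ((g' - e) * m) < p' < expR ((g' + e) * m) ->
  expR (- (e * m)) * p <= p' <= expR (e * m) * p -> `|g' - g| <= 3 * e.
Proof.
move=> m_gt0 /andP[plo phi] /andP[p'lo p'hi] /andP[lower upper].
have : (g' - e) * m < (e + (g + e)) * m.
  rewrite -ltr_expR (lt_trans p'lo)// (le_lt_trans upper)//.
  by rewrite mulrDl expRD ltr_pM2l ?expR_gt0.
have : (- e + (g - e)) * m < (g' + e) * m.
  rewrite -ltr_expR (lt_trans _ p'hi)// (lt_le_trans _ lower)//.
  by rewrite mulrDl mulNr expRD ltr_pM2l ?expR_gt0.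
by rewrite !ltr_pM2r// ler_distl => ? ?; apply/andP; split; lra.
Qed.

(** Used with [x], [y], [c] the exponents at an energy, at a node and at the centre: passing through
    [c] costs [2 * e]. *)
Lemma add_close_le (R : realFieldType) (e c x y : R) :
  `|x - c| <= e -> `|y - c| <= e -> y + e <= x + 3 * e.
Proof. by rewrite !ler_distl => /andP[? ?] /andP[? ?]; lra. Qed.

Lemma interval_nodes (R : realType) (E0 delta : R) (n : nat) : 0 < delta ->
  exists x : nat -> R, (forall i, `|x i - E0| <= delta) /\
    forall (p : {poly R}) (M : R), (size p <= n.+1)%N ->
      (forall i, (i < n.+1)%N -> `|p.[x i]| <= M) ->
      forall t, `|t - E0| <= delta -> `|p.[t]| <= (2 * n.+1)%:R * M.
Proof.
move=> delta_gt0.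
have n1_gt0 : (0 : R) < n.+1%:R by [].
(* Equally spaced points only show that the interval contains enough distinct points; the nodes
   themselves are approximately Fekete. *)
pose a0 (i : 'I_n.+1) : R := E0 + delta * (i%:R / n.+1%:R).
have a0_inj : injective a0.
  have delta_neq0 : delta != 0 by rewrite gt_eqF.
  have n1V_neq0 : n.+1%:R^-1 != 0 :> R by rewrite invr_eq0 gt_eqF.
  move=> i j /addrI/(mulfI delta_neq0)/(mulIf n1V_neq0)/eqP.
  by rewrite eqr_nat => /eqP/val_inj.
have [||a [aE0 aP]] := polynomial_bound_from_nodes
    [set t | `|t - E0| <= delta] (delta + `|E0|) a0 _ _ a0_inj.
- by move=> t /= tE0; rewrite -[t](subrK E0) (le_trans (ler_normD _ _))// lerD2r.
- move=> i /=; rewrite addrC addKr.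
  have quot_ge0 : 0 <= i%:R / n.+1%:R :> R by rewrite divr_ge0.
  rewrite ger0_norm ?(mulr_ge0 (ltW delta_gt0))// ler_piMr ?(ltW delta_gt0)//.
  by rewrite ler_pdivrMr// mul1r ler_nat ltnW.
exists (fun i => a (inord i)); split=> [i|p M sp pM t tE0]; first exact: aE0.
by apply: aP => // i; have := pM i (ltn_ord i); rewrite inord_val.
Qed.

Lemma borel_cantelli_geometric d (Omega : measurableType d) (R : realType)
    (P : probability Omega R) (B : nat -> set Omega) (C q : R) :
  (forall n, measurable (B n)) -> 0 <= C -> 0 < q < 1 ->
  (forall n, (P (B n) <= (C * q ^+ n)%:E)%E) ->
  {ae P, forall omega, exists N, forall n, (N <= n)%N -> ~ B n omega}.
Proof.
move=> mB C_ge0 /andP[q_gt0 q_lt1] PB.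
(* The null set consists of the points lying in infinitely many [B n]. *)
exists (lim_sup_set B); split.
- by apply: bigcapT_measurable => n; apply: bigcup_measurable.
- apply: lim_sup_set_cvg0 => //; apply: (@le_lt_trans _ _ (C * (1 - q)^-1)%:E); last exact: ltry.
  apply: lime_le; first by apply: is_cvg_nneseries => *; exact: measure_ge0.
  apply: nearW => n; apply: (@le_trans _ _ (\sum_(0 <= k < n) (C * q ^+ k)%:E)%E).
    by apply: lee_sum => k _; exact: PB.
  rewrite sumEFin lee_fin.
  have := geometric_le_lim n C_ge0 q_gt0.
  by rewrite gtr0_norm// => /(_ q_lt1).
- move=> omega /= often n _; apply: contrapT => never; apply: often; exists n => k nk Bk.
  by apply: never; exists k.
Qed.

(** * Continuity of the Lyapunov exponent and the local upper bound *)

Section UniformCraigSimon.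
Context {R : realType} {d : measure_display} {Omega : measurableType d}.
Context (P : probability Omega R) (T Tinv : Omega -> Omega) (V : Omega -> R).
Hypothesis T_measurable : measurable_fun setT T.
Hypothesis V_measurable : measurable_fun setT V.
Hypothesis V_bounded : exists M : R, forall omega, `|V omega| <= M.
Hypothesis ldt : uniform_LDT P T Tinv V.

Local Notation det n E omega := (box_det T Tinv V 0 n%:Z E omega).
Local Notation gamma := (lyapunov P T Tinv V).
Local Notation deviation n E eps := (deviation_event P T Tinv V 0 n%:Z E eps).

Lemma ldt_box (E0 eps : R) : 0 < eps -> exists2 eta, 0 < eta & exists N0 : nat,
  forall n E, (N0 < n)%N -> `|E - E0| <= 1 ->
  (P (deviation n E eps) <= (expR (- eta * n.+1%:R))%:E)%E.
Proof.
move=> eps_gt0.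
have [eta [eta_gt0 [N0 ldtN0]]] :=
  ldt `[E0 - 1, E0 + 1]%classic (@segment_compact _ _ _) eps eps_gt0.
exists eta => //; exists N0 => n E N0n EE0.
have -> : n.+1%:R = (n%:Z - 0 + 1)%:~R :> R by rewrite subr0 -natr1 rmorphD.
apply: ldtN0; first by rewrite subr0 ltz_nat.
by rewrite /= in_itv/= -ler_distl.
Qed.

Lemma lyapunov_continuous : continuous gamma.
Proof.
move=> E0; apply/cvgrPdist_le => /= eps eps_gt0.
have e_gt0 : 0 < eps / 4 by rewrite divr_gt0.
have e3_le : 3 * (eps / 4) <= eps by lra.
have [eta eta_gt0 [N0 ldtN0]] := ldt_box E0 (eps / 4) e_gt0.
(* Then [expR (eta * (n + 1)) >= 1 + 2], so each exceptional set has probability below one half. *)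
have [N NP] := eventually_natr_ge R (2 / eta).
pose n := (maxn N0 N).+1.
have n1_gt0 : (0 : R) < n.+1%:R by [].
have dev_small E : `|E - E0| <= 1 -> (P (deviation n E (eps / 4)) < 2^-1%:E)%E.
  move=> EE0; apply: (le_lt_trans (ldtN0 n E _ EE0)); first by rewrite ltnS leq_maxl.
  rewrite lte_fin mulNr expRN ltf_pV2 ?posrE ?expR_gt0//.
  apply: lt_le_trans (expR_ge1Dx _).
  have := NP n.+1; rewrite ler_pdivrMr// mulrC => /(_ _)/wrap[|]; last by lra.
  by rewrite /n !leqW// leq_maxr.
have [L L_gt0 det_lip] := box_det_lipschitz T Tinv V V_bounded n (`|E0| + 1).
pose s := eps / 4 * n.+1%:R.
have s_gt0 : 0 < s by rewrite mulr_gt0.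
pose kappa := 1 - expR (- s).
have kappa_gt0 : 0 < kappa by rewrite subr_gt0 expR_lt1 oppr_lt0.
(* Chosen so that [L * delta] is [kappa] times the lower bound for the determinant at [E0] off the
   deviation event. Neither [n] nor [L] depends on [E] or [omega]. *)
pose delta := kappa * expR ((gamma E0 - eps / 4) * n.+1%:R) / L.
have delta_gt0 : 0 < delta by rewrite divr_gt0// mulr_gt0// expR_gt0.
near=> E.
have EE0 : `|E - E0| <= 1.
  by rewrite distrC; apply: ltW; near: E; exact: (nbhsx_ballx E0 1 ltr01).
have EE0_delta : `|E - E0| <= delta.
  by rewrite distrC; apply: ltW; near: E; exact: (nbhsx_ballx E0 delta delta_gt0).
have [omega good0 good] : exists2 omega,
    ~ deviation n E0 (eps / 4) omega & ~ deviation n E (eps / 4) omega.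
  apply: contrapT => bad.
  have mdev E' := measurable_deviation_event P T Tinv V T_measurable V_measurable n E' (eps / 4).
  have : (P (deviation n E0 (eps / 4) `|` deviation n E (eps / 4)) < 1)%E.
    apply: le_lt_trans (measureU2 _ (mdev _) (mdev _)) _.
    have -> : 1%E = (2^-1%:E + 2^-1%:E : \bar R)%E by rewrite -EFinD; congr _%:E; lra.
    by apply: lteD; apply: dev_small => //; rewrite subrr normr0.
  suff -> : deviation n E0 (eps / 4) `|` deviation n E (eps / 4) = setT.
    by rewrite probability_setT ltxx.
  apply/seteqP; split=> // omega _; apply: contrapT => /not_orP[g0 g].
  by apply: bad; exists omega.
move: good0 good; rewrite !deviation_eventE => /contrapT good0 /contrapT good.
rewrite distrC; apply: le_trans e3_le.
apply: (exponents_close _ _ _ _ _ _ _ n1_gt0 good0 good); apply: norm_close_expR.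
apply: le_trans (det_lip _ _ _ _ _) _.
- by rewrite -[E](subrK E0) (le_trans (ler_normD _ _))// addrC lerD2l.
- by rewrite lerDl.
apply: (@le_trans _ _ (L * delta)); first by rewrite ler_wpM2l// ltW.
rewrite /delta mulrC divfK ?gt_eqF//.
by rewrite ler_wpM2l ?ltW//; case/andP : good0.
Unshelve. all: by end_near.
Qed.

Lemma box_det_le_locally (E0 eps : R) : 0 < eps ->
  exists2 delta, 0 < delta & {ae P, forall omega, exists N2 : nat,
  forall n : nat, (N2 < n)%N -> forall E : R, `|E - E0| <= delta ->
    `|det n E omega| <= expR ((gamma E + eps) * n.+1%:R)}.
Proof.
move=> eps_gt0.
(* One [e] for the deviation at a node, two for the variation of [gamma] through [E0], one for the
   interpolation factor. *)
pose e := eps / 4.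
have e_gt0 : 0 < e by rewrite divr_gt0.
have e_eps g : e + (g + 3 * e) = g + eps by rewrite /e; lra.
have [delta delta_gt0 [delta_le1 gamma_close]] : exists2 delta, 0 < delta &
    delta <= 1 /\ forall E, `|E - E0| <= delta -> `|gamma E - gamma E0| <= e.
  have /cvgrPdist_le/(_ e e_gt0)/nbhs_ballP[r /= r_gt0 rP] := lyapunov_continuous E0.
  (* The 1 keeps the nodes in the range of [ldt_box]; [r / 2] puts the closed interval inside the
     open ball. *)
  exists (Num.min 1 (r / 2)); first by rewrite lt_min ltr01 divr_gt0.
  split=> [|E]; first by rewrite ge_min lexx.
  rewrite le_min => /andP[_ EE0]; rewrite distrC; apply: rP; rewrite /ball/= distrC.
  by rewrite (le_lt_trans EE0)// ltr_pdivrMr// ltr_pMr// ltr1n.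
exists delta => //.
have [eta eta_gt0 [N0 ldtN0]] := ldt_box E0 e e_gt0.
(* The determinant has degree [n + 1], hence [n + 2] nodes at scale [n]. *)
have [x xP] := choice (fun n => interval_nodes R E0 delta n.+1 delta_gt0).
pose B n := if (n <= N0)%N then set0
  else \big[setU/set0]_(i < n.+2) deviation n (x n i) e.
have mdev n E : measurable (deviation n E e).
  exact: measurable_deviation_event.
have mB n : measurable (B n).
  by rewrite /B; case: ifP => // _; apply: bigsetU_measurable.
pose C := 1 + 2 / eta.
have C_ge0 : 0 <= C by rewrite addr_ge0// divr_ge0// ltW.
pose q := expR (- (eta / 2)).
have q01 : 0 < q < 1 by rewrite expR_gt0 expR_lt1 oppr_lt0 divr_gt0.
have PB n : (P (B n) <= (C * q ^+ n)%:E)%E.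
  have Cq_ge0 : 0 <= C * q ^+ n by rewrite mulr_ge0// exprn_ge0// expR_ge0.
  rewrite /B; case: leqP => nN0; first by rewrite measure0 lee_fin.
  apply: le_trans (Boole_inequality P (fun i _ => mdev n (x n i))) _.
  apply: (@le_trans _ _ (\sum_(i < n.+2) (expR (- eta * n.+1%:R))%:E)%E).
    apply: lee_sum => i _; apply: ldtN0 => //.
    by apply: le_trans delta_le1; case: (xP n).
  rewrite sumEFin lee_fin sumr_const card_ord -[leLHS]mulr_natl -[n.+2%:R]natr1.
  apply: le_trans (linear_mul_expRN_le _ _ _ eta_gt0 _) _ => //.
  (* The decay is [q ^+ n.+1]; the extra factor [q <= 1] is dropped. *)
  rewrite ler_wpM2l// mulrC -natr1 mulrDl mul1r expRD expRM_natl.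
  by rewrite ler_piMr ?exprn_ge0 ?expR_ge0// ltW//; case/andP : q01.
have [N1 N1P] := linear_le_expR_eventually R e e_gt0.
apply: filterS (borel_cantelli_geometric _ _ _ P B C q mB C_ge0 q01 PB) => omega [N NB].
exists (maxn N0 (maxn N1 N)) => n; rewrite !gtn_max => /and3P[N0n N1n Nn] E EE0.
have [xE0 poly_bound] := xP n.
have node_bound i : (i < n.+2)%N ->
    `|det n (x n i) omega| <= expR ((gamma E + 3 * e) * n.+1%:R).
  move=> i_lt; have : ~ deviation n (x n i) e omega.
    move: (NB n (ltnW Nn)); rewrite /B leqNgt N0n/=; apply: contra_not.
    by rewrite -(bigcup_mkord n.+2 (fun i => deviation n (x n i) e)) => dev; exists i.
  rewrite deviation_eventE => /contrapT/andP[_ /ltW/le_trans]; apply.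
  rewrite ler_expR ler_pM2r//.
  exact: add_close_le (gamma_close _ EE0) (gamma_close _ (xE0 i)).
rewrite /box_det norm_det_char_poly.
apply: le_trans (poly_bound _ (expR ((gamma E + 3 * e) * n.+1%:R)) _ _ E EE0) _.
- by rewrite size_char_poly subr0 (_ : n%:Z + 1 = n.+1%:Z) ?absz_nat// -addn1 PoszD.
- by move=> i i_lt; rewrite -norm_det_char_poly; exact: node_bound.
apply: le_trans (ler_wpM2r (expR_ge0 _) (N1P n (ltnW N1n))) _.
by rewrite -expRD -mulrDl e_eps.
Qed.

End UniformCraigSimon.

(** * From local bounds to the compact spectrum *)

Theorem theorem5p1 (R : realType) (d : measure_display)
  (Omega : measurableType d) (P : probability Omega R)
  (T Tinv : Omega -> Omega)
  (T_mp : invertible_measure_preserving P T Tinv)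
  (T_ergodic : ergodic P T)
  (V : Omega -> R)
  (V_measurable : measurable_fun [set: Omega] V)
  (V_bounded : exists M : R, forall omega, `|V omega| <= M)
  (sigma : set R)
  (sigma_spectrum : almost_sure_spectrum P T Tinv V sigma)
  (ldt : uniform_LDT P T Tinv V)
  (eps0 : R) (eps0_gt0 : 0 < eps0) :
  {ae P, forall omega, exists N2 : nat, forall n : nat, (N2 < n)%N ->
    forall E : R, sigma E ->
      `|box_det T Tinv V 0 n%:Z E omega|
        <= expR ((lyapunov P T Tinv V E + eps0) * n.+1%:R)}.
Proof.
have [_ _ T_measurable _ _] := T_mp.
have [sigma_compact _] := sigma_spectrum.
(* "Almost surely, for all large n" as one filter, to which [near_covering] applies. *)
pose F : set_system (Omega * nat) := [set S |
  {ae P, forall omega, exists N : nat, forall n, (N < n)%N -> S (omega, n)}].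
have F_filter : Filter F.
  split.
  - by apply: aeW => omega; exists 0%N.
  - move=> A B; rewrite /F /mkset; apply: filterS2 => omega [N NA] [M MB].
    by exists (maxn N M) => n; rewrite gtn_max => /andP[/NA ? /MB].
  - move=> A B AB; rewrite /F /mkset; apply: filterS => omega [N NA].
    by exists N => n /NA/AB.
have /compact_near_coveringP near_cover := sigma_compact.
apply: (near_cover (Omega * nat)%type F (fun omega_n E =>
  `|box_det T Tinv V 0 omega_n.2%:Z E omega_n.1|
    <= expR ((lyapunov P T Tinv V E + eps0) * omega_n.2.+1%:R)) F_filter) => E0 _.
have [delta delta_gt0 det_le] := box_det_le_locally P T Tinv V T_measurable
  V_measurable V_bounded ldt E0 eps0 eps0_gt0.
(* A product neighbourhood is possible because [delta] was fixed before [omega] and [n]. *)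
exists (ball E0 delta, [set omega_n | forall E, `|E - E0| <= delta ->
  `|box_det T Tinv V 0 omega_n.2%:Z E omega_n.1|
    <= expR ((lyapunov P T Tinv V E + eps0) * omega_n.2.+1%:R)]).
  by split; [exact: nbhsx_ballx | exact: det_le].
by move=> [E omega_n] /= [EE0 det_le_n]; apply: det_le_n; rewrite distrC ltW.
Qed.
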